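(* Let $(W,S)$ be a finite Coxeter system with $S=\{s_1,\ldots,s_n\}$ (any ordering of $S$), and for $0\le k\le n$ let $I_k=\{s_1,\ldots,s_k\}$. For $1\le k\le n$ let ${}^{I_{k-1}}(W_{I_k})$ be the set of minimal length representatives of the cosets $W_{I_{k-1}}\backslash W_{I_k}$, and let $\prec$ be a linear ordering on ${}^{I_{k-1}}(W_{I_k})$ extending the weak order. Let $u,w\in W$, and for $0\le k\le n$ let $u_k, w_k\in W_{I_k}$ be the parabolic projections of $u$ and $w$ to $W_{I_k}$. Define $j_0=e$ and, recursively for $1\le k\le n$, $j_k=j_{k-1}z_k$, where $z_k$ is the minimal element with respect to $\prec$ among those $z\in{}^{I_{k-1}}(W_{I_k})$ such that $u_k\le j_{k-1}z$ and $w_k\le j_{k-1}z$. Then this recursion correctly computes the join in weak order: each $z_k$ exists, $j_k$ is the parabolic projection of $u\vee w$ to $W_{I_k}$ for each $k$, and $j_n=u\vee w$.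
   Context: Let $\ell$ be the length function of $(W,S)$, $\Phi$ its root system, $\Phi^+$ the positive roots, $\Phi^-=-\Phi^+$, and $\Phi_w=\Phi^+\cap w(\Phi^-)$ for $w\in W$. The (right) weak order on $W$ is defined by $u\le w$ iff $\Phi_u\subseteq\Phi_w$; since $W$ is finite it is a lattice with join $\vee$. For $I\subseteq S$, $W_I$ is the standard parabolic subgroup generated by $I$. For $I\subseteq J\subseteq S$ set ${}^I(W_J)=\{w\in W_J\mid \ell(sw)>\ell(w)\text{ for all }s\in I\}$. Each $w\in W$ factors uniquely as $w=w_I\,{}^Iw$ with $w_I\in W_I$ and ${}^Iw\in{}^I(W_S)={}^IW$; the parabolic projection of $w$ to $W_I$ is $w_I$. *)

(* Defs.v *)
From HB Require Import structures.
From mathcomp Require Import all_boot all_order all_algebra all_fingroup.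
From mathcomp Require Import all_classical all_reals all_analysis.

Set Implicit Arguments.
Unset Strict Implicit.
Unset Printing Implicit Defensive.

Import Order.TTheory GRing.Theory Num.Theory.

(* The ambient group W is the whole finGroupType [gT]; the simple reflections
   form a set S : {set gT}, and W_I is the generated subgroup <<I>>. *)

Section CoxeterSystem.
Local Open Scope group_scope.
Variables (gT : finGroupType) (S : {set gT}).

(* W = < S | (s t)^m(s,t) = 1 > with m(s,t) the order of s t, the presentation
   being expressed by its universal property among all (possibly infinite)
   groups H.  The morphism phi is then unique, since S generates W. *)
Definition coxeter_system : Prop :=
  [/\ <<S>> = [set: gT],
      {in S, forall s, #[s] = 2%N}
    & forall (H : groupType) (f : gT -> H),
        {in S &, forall s t, (f s * f t) ^+ #[s * t] = 1} ->
        exists2 phi : gT -> H, {morph phi : x y / x * y} & {in S, phi =1 f}].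

Definition is_word (w : gT) (t : seq gT) : bool :=
  all (mem S) t && (\prod_(x <- t) x == w).

(* The prefixes of a shortest word have distinct products, so in a finite group
   shortest words have length less than #|gT|: this bound loses nothing. *)
Definition reduced_word (w : gT) : seq gT :=
  [arg min_(t < [bseq] : #|gT|.-bseq gT | is_word w t) size t].

Definition cox_length (w : gT) : nat := size (reduced_word w).

Definition min_coset_reps (I J : {set gT}) : {set gT} :=
  [set w in <<J>> | [forall s in I, (cox_length w < cox_length (s * w))%N]].

(* The factor w_I of w = w_I * v with w_I in W_I and v in ^I W. *)
Definition parabolic_proj (I : {set gT}) (w : gT) : gT :=
  odflt 1 [pick x in <<I>> | x^-1 * w \in min_coset_reps I S].

End CoxeterSystem.

Section RootSystem.
Local Open Scope classical_set_scope.
Local Open Scope ring_scope.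
Variables (R : realType) (gT : finGroupType) (S : {set gT}).

(* The geometric representation.  Its space R^S is embedded in R^W as the
   functions supported on S; all roots below are supported on S. *)
Local Notation V := {ffun gT -> R^o}.

Definition simple_root (s : gT) : V := [ffun t => (t == s)%:R].

(* B(alpha_s, alpha_t) = - cos (pi / m(s,t)). *)
Definition coxeter_form (a b : V) : R :=
  \sum_(s in S) \sum_(t in S) a s * b t * - cos (pi / (#[s * t]%g)%:R).

Definition reflection (s : gT) (v : V) : V :=
  v - (2 * coxeter_form (simple_root s) v) *: simple_root s.

(* w(v) = s_1(s_2(... s_k(v))) for a reduced word w = s_1 ... s_k; in a Coxeter
   system the result does not depend on the word. *)
Definition geom_act (w : gT) (v : V) : V := foldr reflection v (reduced_word S w).

Definition root_system : set V :=
  [set b | exists w, exists2 s, s \in S & b = geom_act w (simple_root s)].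

Definition pos_roots : set V := [set b | root_system b /\ forall s, 0 <= b s].

Definition neg_roots : set V := [set b | pos_roots (- b)].

Definition inversions (w : gT) : set V := pos_roots `&` geom_act w @` neg_roots.

Definition weak_le (u w : gT) : Prop := inversions u `<=` inversions w.

Definition is_weak_join (u w v : gT) : Prop :=
  [/\ weak_le u v, weak_le w v
    & forall x, weak_le u x -> weak_le w x -> weak_le v x].

(* [prec] restricts on D to a strict linear order extending the weak order. *)
Definition linear_extension (D : {set gT}) (prec : rel gT) : Prop :=
  [/\ {in D, irreflexive prec},
      {in D & &, transitive prec},
      {in D &, forall x y, x != y -> prec x y || prec y x}
    & {in D &, forall x y, weak_le x y -> x != y -> prec x y}].

End RootSystem.

Definition is_minimal (T : Type) (prec : rel T) (C : set T) (z : T) : Prop :=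
  C z /\ forall z', C z' -> ~~ prec z' z.

(* I_k = {s_1, ..., s_k}. *)
Definition initial (gT : finGroupType) (s : seq gT) (k : nat) : {set gT} :=
  [set x in take k s].

(* [prec k] is the chosen order on ^{I_(k-1)}(W_{I_k}), for 1 <= k <= n. *)
Definition join_candidates (R : realType) (gT : finGroupType) (S : {set gT})
    (s : seq gT) (u w : gT) (k : nat) (x : gT) : set gT :=
  [set z | [/\ z \in min_coset_reps S (initial s k.-1) (initial s k),
      weak_le R S (parabolic_proj S (initial s k) u) (x * z)%g
    & weak_le R S (parabolic_proj S (initial s k) w) (x * z)%g]]%classic.

(* The sequences j_0, ..., j_n and z_1, ..., z_n are produced by the
   recursion; the values of [j] and [z] at other indices are irrelevant. *)
Definition join_recursion (R : realType) (gT : finGroupType) (S : {set gT})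
    (s : seq gT) (prec : nat -> rel gT) (u w : gT) (j z : nat -> gT) : Prop :=
  j 0%N = 1%g /\
  forall k, (0 < k <= size s)%N ->
    is_minimal (prec k) (join_candidates R S s u w k (j k.-1)) (z k) /\
    j k = (j k.-1 * z k)%g.

(* Main.v *)
(* Everything is read off the signs of roots: [b] is an inversion of [w] iff
   [b >= 0] and [w^-1 b <= 0], and [W_I] does not change the coordinates of a
   vector outside [I].  Hence the inversions of the projection [v_I] are those
   inversions of [v] that are supported on [I], and an element [x] of [W_I] above
   [u_I] and [w_I] is the projection of an upper bound of [u] and [w], namely the
   one whose inversions are those of [x] and all positive roots not supported on
   [I].  So the projections of [u \/ w] are the joins of the projections, and
   cancelling [j_(k-1)] shows that [v_(k-1)^-1 v_k] is the least candidate at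
   step [k] in weak order, hence its [prec]-minimal candidate. *)

Require Import Defs.
From HB Require Import structures.
From mathcomp Require Import all_boot all_order all_algebra all_fingroup.
From mathcomp Require Import all_classical all_reals all_analysis.
From mathcomp Require Import ring zify.

Set Implicit Arguments.
Unset Strict Implicit.
Unset Printing Implicit Defensive.

Import Order.TTheory GRing.Theory Num.Theory.

(** * Length *)

Section CoxeterLength.
Local Open Scope group_scope.
Variables (gT : finGroupType) (S : {set gT}).
Implicit Types (x y w : gT) (t : seq gT).

Lemma is_word_nil : is_word S 1 [::].
Proof. by rewrite /is_word big_nil eqxx. Qed.

Lemma is_word_cat x y t1 t2 :
  is_word S x t1 -> is_word S y t2 -> is_word S (x * y) (t1 ++ t2).
Proof.
move=> /andP[S1 /eqP <-] /andP[S2 /eqP <-].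
by rewrite /is_word all_cat S1 S2 big_cat /=.
Qed.

Lemma is_word1 s : s \in S -> is_word S s [:: s].
Proof. by move=> sS; rewrite /is_word /= sS big_seq1 eqxx. Qed.

Lemma gen_is_word w : w \in <<S>> -> exists t, is_word S w t.
Proof.
move=> /gen_prodgP[n [c Sc ->]]; exists [seq c i | i <- index_enum 'I_n].
rewrite /is_word big_map eqxx andbT.
by apply/allP => _ /mapP[i _ ->]; apply: Sc.
Qed.

(** Of the prefixes of length at most [#|gT|], two have the same product, and the letters between
    them can be cut out. *)
Lemma is_word_shorten w t :
  is_word S w t -> exists2 t', is_word S w t' & (size t' <= minn #|gT| (size t))%N.
Proof.
have [n] := ubnP (size t); elim: n t => // n IHn t; rewrite ltnS => le_tn tw.
have [le_t|lt_t] := leqP (size t) #|gT|; first by exists t.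
pose f (i : 'I_#|gT|.+1) := \prod_(x <- take i t) x.
have [i [j [ij fij]]] : exists i j : 'I_#|gT|.+1, (i < j)%N /\ f i = f j.
  have /injectivePn[i [j nij fij]] : ~~ injectiveb f.
    by apply/negP => /injectiveP/leq_card; rewrite card_ord ltnn.
  have [ij|ji|/val_inj ij] := ltngtP i j; first by exists i, j.
    by exists j, i.
  by rewrite ij eqxx in nij.
have jt : (j <= size t)%N := ltnW (leq_trans (ltn_ord j) lt_t).
have [||t' wt' let'] := IHn (take i t ++ drop j t); last first.
- by exists t' => //; apply: leq_trans let' _; rewrite geq_minl.
- case/andP: tw => St /eqP tw; apply/andP; split.
    apply/allP => x; rewrite mem_cat => /orP[/mem_take|/mem_drop];
    exact: (allP St).
  by rewrite big_cat /= [X in X * _]fij -big_cat cat_take_drop tw.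
- by rewrite size_cat size_take_min size_drop; lia.
Qed.

Lemma reduced_wordP w : w \in <<S>> ->
  is_word S w (reduced_word S w) /\
  forall t, is_word S w t -> (cox_length S w <= size t)%N.
Proof.
move=> /gen_is_word[t0 /is_word_shorten[t wt]].
rewrite leq_min => /andP[le_t _].
rewrite /cox_length /reduced_word /arg_min /extremum.
set D := pick _.
(* The default [[bseq]] of the [arg min] need not be a word for [w], so [arg_minnP] is applied with
   the bounded word [t] instead; this shows that the pick succeeds. *)
have [r [wr minr rE]] : exists r : #|gT|.-bseq gT, [/\ is_word S w r,
    forall r' : #|gT|.-bseq gT, is_word S w r' -> (size r <= size r')%N &
    odflt [bseq] D = r].
  rewrite /D; case: pickP => [r /andP[wr /forallP minr]|noD] /=.
    by exists r; split=> // r' wr'; apply: (implyP (minr r')).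
  case: (@arg_minnP _ (Bseq le_t) (is_word S w) (fun r => size r) wt) => r wr minr.
  have /negP[] := negbT (noD r); rewrite /= wr /=.
  by apply/forallP => r'; apply/implyP => /minr.
rewrite rE; split=> // t1 /is_word_shorten[t2 wt2]; rewrite leq_min => /andP[le2 le21].
by apply: leq_trans le21; apply: (minr (Bseq le2)).
Qed.

Hypothesis genS : <<S>> = [set: gT].

Lemma mem_genS w : w \in <<S>>.
Proof. by rewrite genS inE. Qed.

Lemma reduced_word_is_word w : is_word S w (reduced_word S w).
Proof. by case: (reduced_wordP (mem_genS w)). Qed.

Lemma cox_length_min w t : is_word S w t -> (cox_length S w <= size t)%N.
Proof. by case: (reduced_wordP (mem_genS w)) => _; apply. Qed.

Lemma cox_length1 : cox_length S 1 = 0%N.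
Proof. by apply/eqP; rewrite -leqn0 (cox_length_min is_word_nil). Qed.

Lemma cox_length_le1 s : s \in S -> (cox_length S s <= 1)%N.
Proof. by move/is_word1/cox_length_min. Qed.

Lemma cox_lengthM x y : (cox_length S (x * y) <= cox_length S x + cox_length S y)%N.
Proof.
rewrite /cox_length -size_cat; apply: cox_length_min.
by apply: is_word_cat; apply: reduced_word_is_word.
Qed.

Lemma cox_lengthMgen w s : s \in S -> (cox_length S (w * s) <= (cox_length S w).+1)%N.
Proof.
by move=> sS; rewrite (leq_trans (cox_lengthM _ _)) // -addn1 leq_add2l cox_length_le1.
Qed.

Lemma cox_lengthgenM w s : s \in S -> (cox_length S (s * w) <= (cox_length S w).+1)%N.
Proof.
by move=> sS; rewrite (leq_trans (cox_lengthM _ _)) // -add1n leq_add2r cox_length_le1.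
Qed.

Hypothesis invS : {in S, forall s, s * s = 1}.

Lemma mulgK_gen w s : s \in S -> w * s * s = w.
Proof. by move=> sS; rewrite -mulgA invS ?mulg1. Qed.

Lemma mulKg_gen w s : s \in S -> s * (s * w) = w.
Proof. by move=> sS; rewrite mulgA invS ?mul1g. Qed.

Lemma invg_gen s : s \in S -> s^-1 = s.
Proof. by move=> sS; apply: (mulgI s); rewrite mulgV invS. Qed.

Lemma is_word_rev w t : is_word S w t -> is_word S w^-1 (rev t).
Proof.
elim: t w => [|s t IHt] w.
  by rewrite /is_word /= big_nil => /eqP <-; rewrite invg1 eqxx.
rewrite /is_word /= big_cons => /andP[/andP[sS tS] /eqP <-].
rewrite rev_cons -cats1 invMg; apply: is_word_cat; first by apply: IHt; rewrite /is_word tS /=.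
by rewrite invg_gen //; apply: is_word1.
Qed.

Lemma cox_lengthV w : cox_length S w^-1 = cox_length S w.
Proof.
have leV x : (cox_length S x^-1 <= cox_length S x)%N.
  by rewrite /cox_length -(size_rev (reduced_word S x)) cox_length_min // is_word_rev // reduced_word_is_word.
by apply/eqP; rewrite eqn_leq leV -{1}(invgK w) leV.
Qed.

Lemma last_letter w : w != 1 ->
  exists2 s, s \in S & cox_length S w = (cox_length S (w * s)).+1.
Proof.
move=> w1; have /andP[] := reduced_word_is_word w.
have : cox_length S w = size (reduced_word S w) by [].
case/lastP: (reduced_word S w) => [|t s].
  by move=> _ _; rewrite big_nil eq_sym (negPf w1).
rewrite size_rcons all_rcons big_rcons /= => lw /andP[sS tS] /eqP wE.
exists s => //; apply/eqP; rewrite eqn_leq {2}lw ltnS; apply/andP; split.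
  by rewrite -{1}(mulgK_gen w sS) cox_lengthMgen.
apply: cox_length_min; rewrite /is_word tS /= -wE.
by rewrite mulgK_gen.
Qed.

End CoxeterLength.

(** * The group of bijections of a type *)

Section BijectionGroup.
Variable T : Type.

(** A target group for the universal property of [W]. All bijections of the representation space
    serve, because the linearity of [geom_act] is read off its definition; keeping the inverse as
    data makes the group operations explicit. *)
Record bijection := Bijection {
  bij_fun :> T -> T;
  bij_inv : T -> T;
  bij_funK : cancel bij_fun bij_inv;
  bij_invK : cancel bij_inv bij_fun }.

Lemma bijection_ext (f g : bijection) : f =1 g -> f = g.
Proof.
case: f g => [f f' fK f'K] [g g' gK g'K] /= /funext fg; subst g.
have : f' = g' by apply/funext => x; rewrite -{1}(g'K x) fK.
by move=> ?; subst g'; congr Bijection; apply: Prop_irrelevance.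
Qed.

Definition bij_one := @Bijection id id (fun=> erefl) (fun=> erefl).

Definition bij_mul (f g : bijection) :=
  Bijection (can_comp (bij_funK f) (bij_funK g)) (can_comp (bij_invK g) (bij_invK f)).

Definition bij_opp (f : bijection) := Bijection (bij_invK f) (bij_funK f).

HB.instance Definition _ := gen_eqMixin bijection.
HB.instance Definition _ := gen_choiceMixin bijection.

Fact bij_mulA : associative bij_mul.
Proof. by move=> f g h; apply: bijection_ext. Qed.

Fact bij_mul1 : left_id bij_one bij_mul.
Proof. by move=> f; apply: bijection_ext. Qed.

Fact bij_mulr1 : right_id bij_one bij_mul.
Proof. by move=> f; apply: bijection_ext. Qed.

Fact bij_mulV : left_inverse bij_one bij_opp bij_mul.
Proof. by move=> f; apply: bijection_ext => x /=; rewrite bij_funK. Qed.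

Fact bij_mulrV : right_inverse bij_one bij_opp bij_mul.
Proof. by move=> f; apply: bijection_ext => x /=; rewrite bij_invK. Qed.

HB.instance Definition _ := isGroup.Build bijection
  bij_mulA bij_mul1 bij_mulr1 bij_mulV bij_mulrV.

Lemma bij_expE (f : bijection) n x : (f ^+ n)%g x = iter n f x.
Proof. by elim: n => // n IHn; rewrite expgS /= -IHn. Qed.

End BijectionGroup.

(** * Geometric representation *)

Section CoxeterForm.
Local Open Scope ring_scope.
Variables (R : realType) (gT : finGroupType) (S : {set gT}).
Local Notation V := {ffun gT -> R^o}.
Local Notation alpha := (simple_root R).
Local Notation B s v := (coxeter_form S (alpha s) v).
Implicit Types (s t : gT) (u v : V) (a b c : R).

Lemma coxeter_formE s v :
  B s v = (s \in S)%:R * \sum_(t in S) v t * - cos (pi / (#[s * t]%g)%:R).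
Proof.
rewrite /coxeter_form; case: (boolP (s \in S)) => sS; last first.
  rewrite mul0r; apply: big1 => r rS; apply: big1 => t tS; rewrite ffunE.
  by have [rs|] := eqVneq r s; [rewrite -rs rS in sS|rewrite !mul0r].
rewrite (bigD1 s) //= [X in _ + X]big1 ?addr0 ?mul1r; last first.
  by move=> r /andP[_ rs]; apply: big1 => t tS; rewrite ffunE (negPf rs) !mul0r.
by apply: eq_bigr => t tS; rewrite ffunE eqxx mul1r.
Qed.

Lemma coxeter_formD s u v : B s (u + v) = B s u + B s v.
Proof.
rewrite !coxeter_formE -mulrDr -big_split /=; congr (_ * _).
by apply: eq_bigr => t _; rewrite ffunE mulrDl.
Qed.

Lemma coxeter_formZ s a v : B s (a *: v) = a * B s v.
Proof.
rewrite !coxeter_formE mulrCA; congr (_ * _); rewrite mulr_sumr.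
by apply: eq_bigr => t _; rewrite ffunE mulrA.
Qed.

Lemma coxeter_form_simple s t : s \in S -> t \in S ->
  B s (alpha t) = - cos (pi / (#[s * t]%g)%:R).
Proof.
move=> sS tS; rewrite coxeter_formE sS mul1r (bigD1 t) //= ffunE eqxx mul1r.
by rewrite big1 ?addr0 // => r /andP[_ rt]; rewrite ffunE (negPf rt) mul0r.
Qed.

Hypothesis invS : {in S, forall s, s * s = 1}%g.

Lemma coxeter_formss s : s \in S -> B s (alpha s) = 1.
Proof.
by move=> sS; rewrite coxeter_form_simple // invS // order1 divr1 cospi opprK.
Qed.

Lemma coxeter_form_sym s t : s \in S -> t \in S ->
  B t (alpha s) = B s (alpha t).
Proof.
move=> sS tS; rewrite !coxeter_form_simple //.
suff -> : (t * s = (s * t)^-1)%g by rewrite orderV.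
by rewrite invMg !(invg_gen invS).
Qed.

Lemma reflection_notin s v : s \notin S -> reflection S s v = v.
Proof.
by move=> sS; rewrite /reflection coxeter_formE (negPf sS) mul0r mulr0 scale0r subr0.
Qed.

Lemma reflectionD s u v : reflection S s (u + v) = reflection S s u + reflection S s v.
Proof. by rewrite /reflection coxeter_formD mulrDr scalerDl opprD addrACA. Qed.

Lemma reflectionZ s a v : reflection S s (a *: v) = a *: reflection S s v.
Proof. by rewrite /reflection coxeter_formZ scalerBr scalerA mulrCA. Qed.

Lemma reflection_simple s : s \in S -> reflection S s (alpha s) = - alpha s.
Proof.
move=> sS; rewrite /reflection coxeter_formss // mulr1.
by rewrite scaler_nat mulr2n opprD addNKr.
Qed.

(** Outside [S] the reflection is the identity. Hence every [s] yields a bijection, as the map on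
    all of [gT] in [coxeter_system] requires. *)
Lemma reflectionK s : involutive (reflection (R := R) S s).
Proof.
move=> v; case: (boolP (s \in S)) => sS; last by rewrite !reflection_notin.
rewrite {2}/reflection reflectionD -scaleNr reflectionZ reflection_simple //.
by rewrite /reflection scalerN scaleNr opprK subrK.
Qed.

Definition reflection_bij s := Bijection (@reflectionK s) (@reflectionK s).

(* The orbit of [v] under the rotation [reflection s \o reflection t]: [C k]
   and [D k] stand for cos (2 k theta) and sin (2 k theta) / sin theta. *)
Lemma iter_rotation s t v c (C D : nat -> R) : s \in S -> t \in S ->
    B s (alpha t) = - c -> 1 - c ^+ 2 != 0 -> C 0%N = 1 -> D 0%N = 0 ->
    (forall k, C k.+1 = (2 * c ^+ 2 - 1) * C k - 2 * c * (1 - c ^+ 2) * D k) ->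
    (forall k, D k.+1 = (2 * c ^+ 2 - 1) * D k + 2 * c * C k) ->
  forall k,
    let p := B s v * C k - (B t v + c * B s v) * D k - B s v in
    let q := B t v * C k + (B s v + c * B t v) * D k - B t v in
    iter k (reflection S s \o reflection S t) v =
    v + ((p + c * q) / (1 - c ^+ 2)) *: alpha s + ((q + c * p) / (1 - c ^+ 2)) *: alpha t.
Proof.
move=> sS tS Bst c1 C0 D0 CS DS; elim=> [|k IHk] p q.
  by rewrite /p /q C0 D0 /= !(mulr1, mulr0, addr0, subr0, subrr, mul0r, scale0r).
rewrite iterS {}IHk /= {}/p {}/q CS DS.
set P := B s v; set Q := B t v; set E := C k; set F := D k.
set x := _ / _; set y := _ / _; set x' := _ / _; set y' := _ / _.
rewrite /reflection !(coxeter_formD, coxeter_formZ) -scaleNr.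
rewrite !(coxeter_formD, coxeter_formZ) coxeter_form_sym // Bst !coxeter_formss //.
rewrite -/P -/Q; apply/ffunP => r; rewrite !ffunE /=.
rewrite /GRing.scale /= /x' /y' /x /y.
by field.
Qed.

End CoxeterForm.

(** * Products of two reflections and alternating words *)

Section DihedralRotation.
Local Open Scope ring_scope.
Variables (R : realType) (gT : finGroupType) (S : {set gT}).
Local Notation V := {ffun gT -> R^o}.
Local Notation alpha := (simple_root R).
Implicit Types (s t x y : gT) (v : V).
Hypothesis invS : {in S, forall s, s * s = 1}%g.

Lemma order_gen_ge2 s t : s \in S -> t \in S -> s != t -> (2 <= #[s * t]%g)%N.
Proof.
move=> sS tS; apply: contraR; rewrite -ltnNge ltnS => le1.
have /eqP := anti_leq (introT andP (conj le1 (order_gt0 _))).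
rewrite order_eq1 => /eqP st; rewrite -(mulg1 s) -(invS tS) mulgA st mul1g //.
Qed.

Lemma angle_bound s t : s \in S -> t \in S -> s != t ->
  0 < (pi / (#[s * t]%g)%:R : R) < pi.
Proof.
move=> sS tS st; have m2 := order_gen_ge2 sS tS st.
have m0 : 0 < (#[s * t]%g)%:R :> R by rewrite ltr0n; apply: leq_trans m2.
rewrite divr_gt0 ?pi_gt0 //= ltr_pdivrMr // ltr_pMr ?pi_gt0 // (ltr_nat _ 1).
exact: m2.
Qed.

Lemma sin_angle_gt0 s t : s \in S -> t \in S -> s != t ->
  0 < sin (pi / (#[s * t]%g)%:R : R).
Proof. by move=> sS tS st; apply: sin_gt0_pi; apply: angle_bound. Qed.

(** For distinct [s] and [t] the product rotates the plane of [alpha s] and [alpha t] by [2 theta].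
    After [m] steps the angle is [2 pi], where the displacement given by [iter_rotation]
    vanishes. *)
Lemma reflection_relation s t : s \in S -> t \in S ->
  ((reflection_bij R invS s * reflection_bij R invS t) ^+ #[s * t] = 1)%g.
Proof.
move=> sS tS; apply: bijection_ext => v; rewrite bij_expE.
(* For [s = t] the angle is [pi] and [sin theta] vanishes, so the closed form cannot be used. *)
have [<-|st] := eqVneq s t; first by rewrite invS // order1 /= reflectionK.
set m := #[s * t]%g; set theta : R := pi / m%:R.
have sn0 : sin theta != 0 by rewrite gt_eqF // sin_angle_gt0.
have m0 : m%:R != 0 :> R by rewrite pnatr_eq0 -lt0n order_gt0.
have s2 : sin theta ^+ 2 = 1 - cos theta ^+ 2 by rewrite sin2cos2.
have cos2 : cos (theta *+ 2) = 2 * cos theta ^+ 2 - 1.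
  by rewrite mulr2n cosD -!expr2 s2; ring.
have sin2 : sin (theta *+ 2) = 2 * cos theta * sin theta by rewrite mulr2n sinD; ring.
pose C k : R := cos (theta *+ 2 *+ k); pose D k : R := sin (theta *+ 2 *+ k) / sin theta.
have CS k : C k.+1 = (2 * cos theta ^+ 2 - 1) * C k
    - 2 * cos theta * (1 - cos theta ^+ 2) * D k.
  by rewrite /C /D mulrSr cosD cos2 sin2 -s2; field.
have DS k : D k.+1 = (2 * cos theta ^+ 2 - 1) * D k + 2 * cos theta * C k.
  by rewrite /C /D mulrSr sinD cos2 sin2; field.
have Bst : coxeter_form S (alpha s) (alpha t) = - cos theta.
  by rewrite coxeter_form_simple.
have c1 : 1 - cos theta ^+ 2 != 0 by rewrite -s2 expf_neq0.
have C0 : C 0%N = 1 by rewrite /C mulr0n cos0.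
have D0 : D 0%N = 0 by rewrite /D mulr0n sin0 mul0r.
have turn : theta *+ 2 *+ m = pi *+ 2.
  by rewrite -mulrnA mulnC mulrnA -(mulr_natr _ m) divfK.
have Cm : C m = 1 by rewrite /C turn cos2pi.
have Dm : D m = 0 by rewrite /D turn sin2pi mul0r.
transitivity (iter m (reflection S s \o reflection S t) v) => //.
rewrite (iter_rotation invS v sS tS Bst c1 C0 D0 CS DS) Cm Dm.
by rewrite !mulr1 !mulr0 addr0 subr0 !subrr mulr0 addr0 mul0r !scale0r !addr0.
Qed.

(** For [n > 0] the last letter is [x] for odd [n] and [y] for even [n], so [if odd n then y else x]
    is the letter that would continue the word on the right. *)
Fixpoint alt x y n : gT := if n is n'.+1 then (x * alt y x n')%g else 1%g.

Lemma alt_dihedral x y n : x \in S -> y \in S ->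
  (alt x y n * (alt y x n)^-1 = (x * y) ^+ n)%g.
Proof.
elim: n x y => [|n IHn] x y xS yS /=; first by rewrite mulgV.
rewrite invMg -mulgA (mulgA (alt y x n)) IHn // (invg_gen invS) //.
elim: n {IHn} => [|n IHn]; first by rewrite !expg0 mul1g expg1.
by rewrite expgS [RHS]expgS -IHn !mulgA.
Qed.

Lemma alt_braid x y : x \in S -> y \in S -> alt x y #[x * y]%g = alt y x #[x * y]%g.
Proof.
by move=> xS yS; apply/eqP; rewrite eq_mulgV1 alt_dihedral // expg_order.
Qed.

Hypothesis genS : <<S>>%g = [set: gT].

Lemma cox_length_alt x y n : x \in S -> y \in S ->
  (cox_length S (alt x y n) <= n)%N.
Proof.
elim: n x y => [|n IHn] x y xS yS /=; first by rewrite cox_length1.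
by apply: leq_trans (cox_lengthgenM genS _ xS) _; rewrite ltnS IHn.
Qed.

(** With one letter more than the order of [x * y], the braid relation makes the tail begin with the
    first letter again, and two letters cancel. Each further letter on the left adds at most one to
    the length. *)
Lemma cox_length_alt_lt x y n : x \in S -> y \in S ->
  (#[x * y]%g <= n)%N -> (cox_length S (alt x y n.+1) < n)%N.
Proof.
move=> xS yS /subnK <-; move: (n - _)%N => {}n.
elim: n x y xS yS => [|n IHn] x y xS yS.
  rewrite add0n /= -alt_braid //; case: #[x * y]%g (order_gt0 (x * y)%g) => // m _ /=.
  by rewrite (mulKg_gen invS) // ltnS cox_length_alt.
have -> : #[x * y]%g = #[y * x]%g.
  by rewrite -orderV invMg !(invg_gen invS).
rewrite addSn [alt _ _ _]/=; apply: leq_ltn_trans (cox_lengthgenM genS _ xS) _.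
by rewrite ltnS; apply: IHn.
Qed.

End DihedralRotation.

(** * The action of the group through reduced words *)

Section GeometricRepresentation.
Local Open Scope ring_scope.
Variables (R : realType) (gT : finGroupType) (S : {set gT}).
Hypothesis coxS : coxeter_system S.
Local Notation V := {ffun gT -> R^o}.
Local Notation alpha := (simple_root R).
Local Notation act := (geom_act S).
Implicit Types (s t x y w : gT) (u v : V).

Lemma cox_gen : <<S>>%g = [set: gT].
Proof. by case: coxS. Qed.

Lemma cox_inv : {in S, forall s, s * s = 1}%g.
Proof. by case: coxS => _ ord2 _ s sS; rewrite -expg2 -(ord2 s sS) expg_order. Qed.

(** The universal property gives a sign character sending each generator to the transposition of
    [bool]; it depends only on the parity of the length. *)
Lemma cox_length_parity w s : s \in S -> cox_length S (w * s) != cox_length S w.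
Proof.
move=> sS; case: coxS => _ _ univ.
pose tau : {perm bool} := tperm true false.
have tau2 : (tau * tau = 1)%g by rewrite tperm2.
have [|phi phiM phiS] := univ {perm bool} (fun=> tau).
  by move=> x y _ _; rewrite tau2 expg1n.
have phi1 : phi 1%g = 1%g by apply: (mulgI (phi 1%g)); rewrite -phiM !mulg1.
have phiE x : phi x = (tau ^+ cox_length S x)%g.
  case/andP: (reduced_word_is_word cox_gen x) => + /eqP xE.
  rewrite -[in LHS]xE /cox_length; elim: (reduced_word S x) => [|t r IHr] /=.
    by rewrite big_nil.
  by case/andP=> tS rS; rewrite big_cons phiM phiS // IHr // expgS.
apply/eqP => len; have := phiM w s; rewrite (phiS s sS) !phiE len => /eqP.
rewrite -{1}[(tau ^+ _)%g]mulg1 (inj_eq (mulgI _)) => /eqP/permP/(_ true).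
by rewrite perm1 tpermL.
Qed.

(** The universal property extends the reflections to a homomorphism, and evaluating it on a reduced
    word gives [geom_act]. Hence the action does not depend on the word. *)
Lemma geom_act_hom : exists2 phi : gT -> bijection V,
  {morph phi : x y / (x * y)%g} & forall w v, act w v = phi w v.
Proof.
case: (coxS) => _ _ univ.
have [|phi phiM phiS] := univ (bijection V) (reflection_bij R cox_inv).
  by move=> s t sS tS; apply: reflection_relation.
have phi1 : phi 1%g = 1%g by apply: (mulgI (phi 1%g)); rewrite -phiM !mulg1.
exists phi => // w v; rewrite /geom_act.
case/andP: (reduced_word_is_word cox_gen w) => + /eqP wE.
rewrite -[in RHS]wE; elim: (reduced_word S w) => [|t r IHr] /=.
  by rewrite big_nil phi1.
by case/andP=> tS rS; rewrite big_cons phiM phiS // IHr.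
Qed.

Lemma geom_actM x y v : act (x * y)%g v = act x (act y v).
Proof. by have [phi phiM actE] := geom_act_hom; rewrite !actE phiM. Qed.

Lemma geom_act1 v : act 1%g v = v.
Proof.
have [phi phiM actE] := geom_act_hom; rewrite actE.
have -> // : phi 1%g = 1%g by apply: (mulgI (phi 1%g)); rewrite -phiM !mulg1.
Qed.

Lemma geom_actK w : cancel (act w) (act w^-1%g : V -> V).
Proof. by move=> v; rewrite -geom_actM mulVg geom_act1. Qed.

Lemma geom_actVK w : cancel (act w^-1%g) (act w : V -> V).
Proof. by move=> v; rewrite -geom_actM mulgV geom_act1. Qed.

Lemma geom_actD w u v : act w (u + v) = act w u + act w v.
Proof.
by rewrite /geom_act; elim: reduced_word => //= s r ->; rewrite reflectionD.
Qed.

Lemma geom_actZ w (a : R) v : act w (a *: v) = a *: act w v.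
Proof.
by rewrite /geom_act; elim: reduced_word => //= s r ->; rewrite reflectionZ.
Qed.

Lemma geom_actN w v : act w (- v) = - act w v.
Proof. by rewrite -scaleN1r geom_actZ scaleN1r. Qed.

Lemma geom_act0 w : act w 0 = 0 :> V.
Proof. by apply: (addrI (act w 0)); rewrite -geom_actD !addr0. Qed.

Lemma geom_act_sum w (I : finType) (P : pred I) (F : I -> V) :
  act w (\sum_(i | P i) F i) = \sum_(i | P i) act w (F i).
Proof. exact: (big_morph (act w) (geom_actD w) (geom_act0 w)). Qed.

Lemma geom_act_gen s v : s \in S -> act s v = reflection S s v.
Proof.
move=> sS; rewrite /geom_act.
have : (cox_length S s <= 1)%N := cox_length_le1 cox_gen sS.
have /andP[] := reduced_word_is_word cox_gen s; rewrite /cox_length.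
case: reduced_word => [|t [|//]] /=.
  move=> _; rewrite big_nil => /eqP s1 _; case: coxS => _ /(_ s sS) + _.
  by rewrite -s1 order1.
by move=> _; rewrite big_seq1 => /eqP ->.
Qed.

(** Each reflection step is the recurrence [sin ((n+2) theta) = 2 cos theta sin ((n+1) theta) - sin
    (n theta)]. Both coefficients are nonnegative as long as [n] is below the order of [x * y]. *)
Lemma alt_simple x y n : x \in S -> y \in S -> x != y ->
  let theta : R := pi / (#[x * y]%g)%:R in
  act (alt x y n) (alpha (if odd n then y else x)) =
  (sin (n.+1%:R * theta) / sin theta) *: alpha x + (sin (n%:R * theta) / sin theta) *: alpha y.
Proof.
elim: n x y => [|n IHn] x y xS yS xy theta.
  rewrite geom_act1 mul1r mul0r sin0 mul0r scale0r addr0 divff ?scale1r //.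
  by rewrite gt_eqF // (sin_angle_gt0 R cox_inv).
have Exy : #[y * x]%g = #[x * y]%g.
  by rewrite -orderV invMg !(invg_gen cox_inv).
have sn0 : sin theta != 0 by rewrite gt_eqF // (sin_angle_gt0 R cox_inv).
have := IHn y x yS xS; rewrite eq_sym => /(_ xy); rewrite Exy -/theta /= => {}IHn.
rewrite /= if_neg geom_actM {}IHn geom_actD !geom_actZ !geom_act_gen //.
rewrite (reflection_simple R cox_inv) // {1}/reflection coxeter_form_simple // -/theta.
apply/ffunP => r; rewrite !ffunE /GRing.scale /=.
have -> : sin (n.+2%:R * theta) = 2 * cos theta * sin (n.+1%:R * theta) - sin (n%:R * theta).
  have -> : n.+2%:R * theta = n.+1%:R * theta + theta by rewrite -[n.+2]addn1 natrD mulrDl mul1r.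
  have -> : n%:R * theta = n.+1%:R * theta - theta by rewrite -[n.+1]addn1 natrD mulrDl mul1r addrK.
  by rewrite sinB sinD; ring.
by field.
Qed.

End GeometricRepresentation.

(** * Roots *)

Section Roots.
Local Open Scope ring_scope.
Variables (R : realType) (gT : finGroupType) (S : {set gT}).
Hypothesis coxS : coxeter_system S.
Local Notation V := {ffun gT -> R^o}.
Local Notation alpha := (simple_root R).
Local Notation act := (geom_act S).
Local Notation root := (@root_system R gT S).
Implicit Types (s t x y z w : gT) (u v b c : V) (I : {set gT}).

Definition nonneg v : Prop := forall t, 0 <= v t.

Lemma nonneg_simple s : nonneg (alpha s).
Proof. by move=> t; rewrite ffunE ler0n. Qed.

Lemma nonnegD u v : nonneg u -> nonneg v -> nonneg (u + v).
Proof. by move=> u0 v0 t; rewrite ffunE addr_ge0. Qed.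

Lemma nonnegZ (a : R) v : 0 <= a -> nonneg v -> nonneg (a *: v).
Proof. by move=> a0 v0 t; rewrite ffunE /GRing.scale /= mulr_ge0. Qed.

Lemma nonneg_sum I (F : gT -> V) :
  (forall s, s \in I -> nonneg (F s)) -> nonneg (\sum_(s in I) F s).
Proof.
move=> F0; apply: big_ind => //; first by move=> t; rewrite ffunE.
exact: nonnegD.
Qed.

Lemma nonneg_anti v : nonneg v -> nonneg (- v) -> v = 0.
Proof.
move=> v0 Nv0; apply/ffunP => t; apply/eqP; rewrite ffunE eq_le v0 andbT.
by have := Nv0 t; rewrite ffunE oppr_ge0.
Qed.

(* Humphreys, Reflection groups and Coxeter groups, 5.4: peel off from the
   right of [w] a longest possible alternating word in two letters [x], [y]
   that would end in [s] after one more step.  The remaining factor has [x]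
   and [y] as ascents, so induction and the dihedral formula apply. *)
Lemma ascent_nonneg w s : s \in S ->
  (cox_length S w < cox_length S (w * s)%g)%N -> nonneg (act w (alpha s)).
Proof.
have genS := cox_gen coxS; have invS := cox_inv coxS.
have [n] := ubnP (cox_length S w); elim: n w s => // n IHn w s; rewrite ltnS => lwn sS lws.
have [->|w1] := eqVneq w 1%g; first by rewrite geom_act1 //; apply: nonneg_simple.
have [t tS lwt] := last_letter genS invS w1.
have ts : t != s by apply: contraTneq lws => <-; rewrite lwt; lia.
pose P k := [exists v, exists x, exists y,
  [&& x \in S, y \in S, x != y, (if odd k then y else x) == s,
      w == (v * alt x y k)%g & cox_length S w == cox_length S v + k]%N].
(* As [t] is a descent and [s] an ascent, the one-letter word [t] qualifies. So the maximal [k] is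
   positive, and [v] is strictly shorter than [w]. *)
have P1 : P 1%N.
  apply/existsP; exists (w * t)%g; apply/existsP; exists t; apply/existsP; exists s.
  by rewrite tS sS ts eqxx /= mulg1 (mulgK_gen invS) // eqxx addn1 lwt eqxx.
have Ple k : P k -> (k <= cox_length S w)%N.
  by move=> /existsP[v /existsP[x /existsP[y /and5P[_ _ _ _ /andP[_ /eqP->]]]]]; lia.
have [k Pk maxk] := ex_maxnP (ex_intro (fun k => is_true (P k)) 1%N P1) Ple.
have k_gt0 := maxk _ P1.
case/existsP: Pk => v /existsP[x /existsP[y /and5P[xS yS xy /eqP sE /andP[/eqP wE /eqP lwE]]]].
have lw : cox_length S w = (cox_length S v + k)%N :> nat := lwE.
(* If [x] were a descent of [v], absorbing the first [x] of the alternating word into [v] would give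
   [w] a shorter expression. *)
have vx : (cox_length S v < cox_length S (v * x)%g)%N.
  have := cox_length_parity coxS v xS; rewrite neq_ltn => /orP[|//] lt.
  suff : (cox_length S w <= cox_length S (v * x)%g + k.-1)%N by lia.
  have -> : w = (v * x * alt y x k.-1)%g.
    by rewrite wE; case: (k) k_gt0 => // k' _ /=; rewrite mulgA.
  by apply: leq_trans (cox_lengthM genS _ _) _; rewrite leq_add2l cox_length_alt.
(* If [y] were a descent of [v], moving it to the front of the alternating word would contradict the
   maximality of [k]. *)
have vy : (cox_length S v < cox_length S (v * y)%g)%N.
  have := cox_length_parity coxS v yS; rewrite neq_ltn => /orP[|//] lt.
  suff /maxk : P k.+1 by rewrite ltnn.
  have lvy := cox_lengthMgen genS (v * y)%g yS; rewrite (mulgK_gen invS) // in lvy.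
  apply/existsP; exists (v * y)%g; apply/existsP; exists y; apply/existsP; exists x.
  rewrite xS yS eq_sym xy /= if_neg sE eqxx wE mulgA (mulgK_gen invS) // eqxx /=.
  by rewrite -wE lw (_ : cox_length S v = (cox_length S (v * y)%g).+1) ?addSnnS //;
    apply/eqP; rewrite eqn_leq lvy.
have lvw : (cox_length S v < n)%N by lia.
have := alt_simple R coxS k xS yS xy; rewrite sE => altE.
rewrite wE geom_actM // altE geom_actD !geom_actZ.
set m := #[x * y]%g; have m0 : 0 < m%:R :> R by rewrite ltr0n order_gt0.
(* Otherwise the alternating word continued by [s] would have length below [k], making [w * s]
   shorter than [w]. *)
have km : (k < m)%N.
  rewrite ltnNge; apply/negP => /(cox_length_alt_lt invS genS xS yS) lt.
  suff wsE : (w * s)%g = (v * alt x y k.+1)%g.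
    by have := cox_lengthM genS v (alt x y k.+1); rewrite -wsE; lia.
  rewrite wE -mulgA; congr mulg; rewrite -sE.
  elim: (k) (x) (y) => [|i IHi] x' y' /=; first by rewrite mulg1 mul1g.
  by rewrite if_neg -mulgA IHi.
have sin_ge0 i : (i <= m)%N -> 0 <= sin (i%:R * (pi / m%:R)) / sin (pi / m%:R) :> R.
  move=> im; apply: divr_ge0; last exact/ltW/(sin_angle_gt0 R invS).
  apply: sin_ge0_pi; rewrite mulrA mulrAC; apply/andP; split.
    by rewrite mulr_ge0 ?divr_ge0 ?pi_ge0.
  by rewrite ler_piMl ?pi_ge0 // ler_pdivrMr // mul1r ler_nat.
by apply: nonnegD; apply: nonnegZ; rewrite ?sin_ge0 // 1?ltnW //; apply: IHn.
Qed.

Lemma descent_nonneg w s : s \in S ->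
  (cox_length S (w * s)%g < cox_length S w)%N -> nonneg (- act w (alpha s)).
Proof.
move=> sS; rewrite -{2}(mulgK_gen (cox_inv coxS) w sS) => /ascent_nonneg -/(_ sS).
rewrite geom_actM // (geom_act_gen coxS _ sS) (reflection_simple R (cox_inv coxS)) //.
by rewrite geom_actN.
Qed.

Lemma root_act w b : root b -> root (act w b).
Proof.
by move=> [x [s sS ->]]; exists (w * x)%g; exists s => //; rewrite geom_actM.
Qed.

Lemma root_simple s : s \in S -> root (alpha s).
Proof. by move=> sS; exists 1%g; exists s; rewrite ?geom_act1. Qed.

Lemma root_opp b : root b -> root (- b).
Proof.
move=> [x [s sS ->]]; exists (x * s)%g; exists s => //.
rewrite geom_actM // (geom_act_gen coxS _ sS) (reflection_simple R (cox_inv coxS)) //.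
by rewrite geom_actN.
Qed.

Lemma root_sign b : root b -> nonneg b \/ nonneg (- b).
Proof.
move=> [w [s sS ->]]; have := cox_length_parity coxS w sS; rewrite neq_ltn.
by case/orP => [/descent_nonneg|/ascent_nonneg]; [right|left]; auto.
Qed.

Lemma root_neq0 b : root b -> b <> 0.
Proof.
move=> [w [s sS ->]] /(congr1 (act w^-1%g)); rewrite geom_actK // geom_act0.
by move=> /ffunP/(_ s); rewrite !ffunE eqxx => /eqP; rewrite oner_eq0.
Qed.

Lemma root_pos_neg b : root b -> nonneg b -> ~ nonneg (- b).
Proof. by move=> rb pb nb; apply: (root_neq0 rb); apply: nonneg_anti. Qed.

Lemma length_ltP w s : s \in S ->
  (cox_length S w < cox_length S (w * s)%g)%N <-> nonneg (act w (alpha s)).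
Proof.
move=> sS; split=> [|pos]; first exact: ascent_nonneg.
have := cox_length_parity coxS w sS; rewrite neq_ltn => /orP[|//].
move/(descent_nonneg sS) => neg; case: (root_pos_neg (b := act w (alpha s)) _ pos neg).
exact/root_act/root_simple.
Qed.

Lemma inversionsP w b : inversions S w b <->
  [/\ root b, nonneg b & nonneg (- act w^-1%g b)].
Proof.
split=> [[[rb pb] [c [_ pc] cb]]|[rb pb nb]].
  by rewrite -cb; split; rewrite ?cb // -cb geom_actK.
split; first by split.
exists (act w^-1%g b); last by rewrite geom_actVK.
by split=> //; apply/root_opp/root_act.
Qed.

Definition supported I v : Prop := forall r, r \notin I -> v r = 0.

Lemma supported_simple I s : s \in I -> supported I (alpha s).
Proof. by move=> sI r rI; rewrite ffunE; case: eqP rI => // ->; rewrite sI. Qed.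

(** The reflection in [s] changes only the coordinate at [s]. *)
Lemma geom_act_out I w v r : I \subset S -> w \in <<I>>%g -> r \notin I ->
  act w v r = v r.
Proof.
move=> IS /gen_is_word[t /andP[It /eqP<-]] rI; elim: t It => [|s t IHt] /=.
  by rewrite big_nil geom_act1.
case/andP=> sI tI; rewrite big_cons geom_actM // (geom_act_gen coxS _ (fintype.subsetP IS s sI)).
rewrite !ffunE IHt // (_ : r == s = false) ?mulr0n.
  by rewrite /GRing.scale /= mulr0 subr0.
by apply: contraNF rI => /eqP->.
Qed.

Lemma supported_act I w v : I \subset S -> w \in <<I>>%g ->
  supported I v -> supported I (act w v).
Proof. by move=> IS wI sv r rI; rewrite (geom_act_out _ IS wI) ?sv. Qed.

Lemma supported_root b : root b -> supported S b.
Proof.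
move=> [w [s sS ->]]; apply: supported_act; rewrite ?(mem_genS (cox_gen coxS)) //.
exact: supported_simple.
Qed.

Lemma supported_sum I v : supported I v -> v = \sum_(s in I) v s *: alpha s.
Proof.
move=> sv; apply/ffunP => r; rewrite sum_ffunE.
under eq_bigr do rewrite !ffunE /GRing.scale /=.
have [rI|rI] := boolP (r \in I).
  rewrite (bigD1 r) //= eqxx mulr1 big1 ?addr0 // => s /andP[_ sr].
  by rewrite eq_sym (negPf sr) mulr0.
rewrite sv // big1 // => s sI; case: eqP => [rs|]; last by rewrite mulr0.
by rewrite -rs (negPf rI) in sI.
Qed.

Lemma nonneg_act I x v : supported I v -> nonneg v ->
  (forall s, s \in I -> nonneg (act x (alpha s))) -> nonneg (act x v).
Proof.
move=> sv v0 x0; rewrite (supported_sum sv) geom_act_sum //.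
by apply: nonneg_sum => s sI; rewrite geom_actZ; apply: nonnegZ; auto.
Qed.

Lemma nonpos_act I x v : supported I v -> nonneg v ->
  (forall s, s \in I -> nonneg (- act x (alpha s))) -> nonneg (- act x v).
Proof.
move=> sv v0 x0; rewrite (supported_sum sv) geom_act_sum // -sumrN.
by apply: nonneg_sum => s sI; rewrite geom_actZ -scalerN; apply: nonnegZ; auto.
Qed.

(** The coordinates outside [I] are unchanged by [w], so they are both nonnegative and
    nonpositive. *)
Lemma sign_change_supported I w v : I \subset S -> w \in <<I>>%g ->
  nonneg v -> nonneg (- act w v) -> supported I v.
Proof.
move=> IS wI v0 nv r rI; apply/eqP; rewrite eq_le v0 andbT.
by have := nv r; rewrite ffunE (geom_act_out _ IS wI) // oppr_ge0.
Qed.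

(** In an element of maximal length of [<<I>>] every generator in [I] is a right descent, equality
    of lengths being excluded by parity. *)
Lemma longest_elt I : I \subset S ->
  exists2 x, x \in <<I>>%g & forall s, s \in I -> nonneg (- act x (alpha s)).
Proof.
move=> IS; case: (@arg_maxnP _ 1%g (mem <<I>>%g) (cox_length S) (group1 _)) => x xI maxx.
exists x => // s sI; have sS := fintype.subsetP IS s sI.
have le : (cox_length S (x * s)%g <= cox_length S x)%N := maxx _ (groupM xI (mem_gen sI)).
by apply: descent_nonneg => //; rewrite ltn_neqAle le cox_length_parity.
Qed.

End Roots.

(** * Weak order and parabolic projections *)

Section WeakOrder.
Local Open Scope ring_scope.
Variables (R : realType) (gT : finGroupType) (S : {set gT}).
Hypothesis coxS : coxeter_system S.
Local Notation V := {ffun gT -> R^o}.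
Local Notation alpha := (simple_root R).
Local Notation act := (geom_act S).
Local Notation root := (@root_system R gT S).
Local Notation wle := (weak_le R S).
Implicit Types (s t x y z u v w : gT) (b c : V) (I J : {set gT}).

Lemma weak_leP u w : wle u w <-> forall b, root b -> nonneg b ->
  nonneg (- act u^-1%g b) -> nonneg (- act w^-1%g b).
Proof.
split=> [le_uw b rb pb nb|uw b /(inversionsP coxS)[rb pb nb]].
  by have /(inversionsP coxS)[] : inversions S w b by apply/le_uw/(inversionsP coxS).
by apply/(inversionsP coxS); split=> //; apply: uw.
Qed.

Lemma weak_le_trans y x z : wle x y -> wle y z -> wle x z.
Proof. by move=> xy yz b /xy/yz. Qed.

(** If [x] and [y] differ, [x^-1 * y] has a right descent [s]. The root [y (alpha s)] is made
    negative by [x^-1] and positive by [y^-1], so it or its opposite is an inversion of exactly one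
    of the two. *)
Lemma weak_le_anti x y : wle x y -> wle y x -> x = y.
Proof.
move=> /weak_leP xy /weak_leP yx; apply/eqP; rewrite eq_mulVg1.
apply: contraT => /(last_letter (cox_gen coxS) (cox_inv coxS))[s sS len].
have := @descent_nonneg R _ _ coxS (x^-1 * y)%g s sS.
rewrite len => /(_ (ltnSn _)); rewrite geom_actM //.
set b := act y (alpha s) => nb.
have rb : root b by apply/root_act/root_simple.
have yb : act y^-1%g b = alpha s by rewrite geom_actK.
have [pb|nb'] := root_sign coxS rb.
  have := xy b rb pb nb; rewrite yb => /(root_pos_neg coxS (root_simple R coxS sS)).
  by case; apply: nonneg_simple.
have := yx (- b) (root_opp coxS rb) nb'; rewrite !geom_actN // yb !opprK.
move=> /(_ (@nonneg_simple R _ s)) pb.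
by case: (root_pos_neg coxS (root_act coxS _ rb) pb nb).
Qed.

Lemma weak_le1 x : wle 1%g x.
Proof.
apply/weak_leP => b rb pb; rewrite invg1 geom_act1 // => nb.
by case: (root_pos_neg coxS rb pb nb).
Qed.

(** If an inversion [b] of [z] were lost, the positive root [- z^-1 b] would change sign under
    [x^-1], hence be supported on [I]; then [z] would send it to a positive root, but its image is
    [- b]. *)
Lemma weak_leMr I z x : I \subset S -> x \in <<I>>%g ->
  (forall s, s \in I -> nonneg (act z (alpha s))) -> wle z (z * x)%g.
Proof.
move=> IS xI zI; apply/weak_leP => b rb pb nb; rewrite invMg geom_actM // -geom_actN //.
have rc : root (- act z^-1%g b) by apply/(root_opp coxS)/root_act.
have [//|nc] := root_sign coxS (root_act coxS x^-1%g rc).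
have sc := sign_change_supported coxS IS (groupVr xI) nb nc.
have := nonneg_act sc nb zI; rewrite geom_actN // geom_actVK //.
by move/(root_pos_neg coxS rb pb).
Qed.

(** * Joins of covers [z * s] through the longest element of a parabolic subgroup *)

Section LongestElement.
Variables (I : {set gT}) (m : gT).
Hypotheses (IS : I \subset S) (mI : m \in <<I>>%g).
Hypothesis longest_m : forall s, s \in I -> nonneg (- act m (alpha s)).

(** An inversion of [z * s] that is not one of [z] is the [z]-image of a positive root supported on
    [s] alone, and [m] makes such a root negative. *)
Lemma weak_le_longest z s : s \in I ->
  (forall t, t \in I -> nonneg (act z (alpha t))) -> wle (z * s)%g (z * m^-1)%g.
Proof.
move=> sI zI; have sS := fintype.subsetP IS s sI.
have /weak_leP zm := weak_leMr IS (groupVr mI) zI.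
apply/weak_leP => b rb pb; rewrite !invMg invgK (invg_gen (cox_inv coxS) sS).
rewrite !geom_actM // => nb.
have [pc|/(zm b rb pb)] := root_sign coxS (root_act coxS z^-1%g rb).
  have sS1 : [set s] \subset S by rewrite finset.sub1set.
  have sc := sign_change_supported coxS sS1 (mem_gen (finset.set11 s)) pc nb.
  by apply: (nonpos_act sc) => // t /finset.set1P->; apply: longest_m.
by rewrite invMg invgK geom_actM.
Qed.

(** An inversion of [z * m^-1] that is not one of [z] is the [z]-image of a positive root supported
    on [I], so [x^-1] makes it negative by linearity. *)
Lemma weak_le_longest_min z x : wle z x ->
  (forall t, t \in I -> nonneg (- act x^-1%g (act z (alpha t)))) -> wle (z * m^-1)%g x.
Proof.
move=> /weak_leP zx xI; apply/weak_leP => b rb pb.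
rewrite invMg invgK geom_actM // => nb.
have [pc|/(zx b rb pb)//] := root_sign coxS (root_act coxS z^-1%g rb).
have sc := sign_change_supported coxS IS mI pc nb.
have := @nonpos_act R _ S I (x^-1 * z)%g _ sc pc.
rewrite geom_actM // geom_actVK //; apply=> t tI; rewrite geom_actM //; exact: xI.
Qed.

End LongestElement.

(** If there is no such [s], then [x^-1 * z] keeps all simple roots, hence all positive roots,
    positive. This gives [x] below [z], and antisymmetry applies. *)
Lemma weak_le_ascent z x : wle z x -> z != x ->
  exists s, [/\ s \in S, nonneg (act z (alpha s)) & nonneg (- act x^-1%g (act z (alpha s)))].
Proof.
move=> zx; apply: contraNP => noS; apply/eqP/weak_le_anti => //.
have Spos s : s \in S -> nonneg (act (x^-1 * z)%g (alpha s)).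
  move=> sS; rewrite geom_actM //.
  have rb : root (act z (alpha s)) by apply/root_act/root_simple.
  have [//|nb] := root_sign coxS (root_act coxS x^-1%g rb).
  have [pb|pb] := root_sign coxS rb; first by case: noS; exists s.
  move/weak_leP: zx => /(_ _ (root_opp coxS rb) pb).
  rewrite !geom_actN // geom_actK // !opprK => /(_ (@nonneg_simple R _ s)).
  by [].
apply/weak_leP => b rb pb nb.
have rc := root_act coxS z^-1%g rb.
have [pc|//] := root_sign coxS rc.
have := nonneg_act (supported_root coxS rc) pc Spos.
rewrite geom_actM // geom_actVK // => pd.
by case: (root_pos_neg coxS (root_act coxS _ rb) pd nb).
Qed.

Lemma weak_le_cover z x s : wle z x -> s \in S ->
  nonneg (- act x^-1%g (act z (alpha s))) -> wle (z * s)%g x.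
Proof.
move=> zx sS nb; rewrite -(invg_gen (cox_inv coxS) sS).
have sS1 : [set s] \subset S by rewrite finset.sub1set.
by apply: (weak_le_longest_min sS1 (mem_gen (finset.set11 s))) => // t /finset.set1P->.
Qed.

(* Bjorner-Edelman-Ziegler: joins of pairs covering a common element suffice. *)
Lemma weak_join_exists x y : exists v, is_weak_join R S x y v.
Proof.
(* The induction runs over common lower bounds [z] of [x] and [y], starting from [1]; the measure is
   the number of elements above [z]. *)
have [n] := ubnP #|[set w : gT | `[< wle 1%g w >]]|.
move: (weak_le1 x) (weak_le1 y); move: 1%g => z zx zy.
elim: n z x y zx zy => // n IHn z x y zx zy; rewrite ltnS => le_n.
have above z' : wle z z' -> ~ wle z' z -> (#|[set w : gT | `[< wle z' w >]]| < n)%N.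
  move=> zz' z'z; apply: leq_trans le_n; apply: proper_card; apply/properP; split.
    by apply/fintype.subsetP => w; rewrite !finset.in_set => /asboolP z'w;
      apply/asboolP; exact: weak_le_trans zz' z'w.
  by exists z; rewrite finset.in_set; apply/asboolP.
have ascent_above s : s \in S -> nonneg (act z (alpha s)) ->
    (#|[set w : gT | `[< wle (z * s)%g w >]]| < n)%N.
  move=> sS zs; have sS1 : [set s] \subset S by rewrite finset.sub1set.
  have zzs : wle z (z * s)%g.
    by apply: (weak_leMr sS1 (mem_gen (finset.set11 s))) => t /finset.set1P->.
  apply: above => // zsz; have /eqP := weak_le_anti zzs zsz.
  rewrite -{1}[z]mulg1 (inj_eq (mulgI z)) => /eqP s1.
  case: coxS => _ /(_ s sS) + _; by rewrite -s1 order1.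
have [zxE|/eqP zxN] := eqVneq z x; first by exists y; split; rewrite -?zxE.
have [zyE|/eqP zyN] := eqVneq z y; first by exists x; split; rewrite -?zyE.
have [s [sS zs xs]] := weak_le_ascent zx (introN eqP zxN).
have [t [tS zt yt]] := weak_le_ascent zy (introN eqP zyN).
have IS : [set s; t] \subset S by rewrite finset.subUset !finset.sub1set sS tS.
have [m mI ml] := longest_elt R coxS IS.
have Ipos r : r \in [set s; t] -> nonneg (act z (alpha r)) by case/finset.set2P=> ->.
have zsm := weak_le_longest IS mI ml (finset.set21 s t) Ipos.
have ztm := weak_le_longest IS mI ml (finset.set22 s t) Ipos.
(* The bridge between [x] and [y] is [z * m^-1], which is above [z * s] and [z * t]. First [x] is
   joined with it above [z * s], then the result [p] with [y] above [z * t]. *)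
have [p [xp mp pmin]] :=
  IHn _ _ _ (weak_le_cover zx sS xs) zsm (ascent_above s sS zs).
have [q [pq yq qmin]] :=
  IHn _ _ _ (weak_le_trans ztm mp) (weak_le_cover zy tS yt) (ascent_above t tS zt).
exists q; split=> //; first exact: weak_le_trans xp pq.
move=> r xr yr; apply: qmin => //; apply: pmin => //.
(* A common upper bound of [x] and [y] inherits the inversion [z (alpha s)] from [x] and
   [z (alpha t)] from [y], so it is above [z * m^-1]. *)
apply: (weak_le_longest_min IS mI); first exact: weak_le_trans zx xr.
move=> r' /finset.set2P[]->.
  by move/weak_leP: xr; apply=> //; apply/root_act/root_simple.
by move/weak_leP: yr; apply=> //; apply/root_act/root_simple.
Qed.

(** * Minimal coset representatives and parabolic projections *)

Lemma min_coset_repsP I J z : I \subset S ->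
  reflect (z \in <<J>>%g /\ forall s, s \in I -> nonneg (act z^-1%g (alpha s)))
    (z \in min_coset_reps S I J).
Proof.
move=> IS; rewrite finset.in_set; apply: (iffP andP) => -[zJ zI]; split=> //.
  move=> s sI; have sS := fintype.subsetP IS s sI.
  apply/(length_ltP R coxS) => //.
  (* Inversion preserves length and turns left multiplication by [s] into right multiplication,
     where [length_ltP] applies. *)
  rewrite -(invg_gen (cox_inv coxS) sS) -invMg !(cox_lengthV (cox_gen coxS) (cox_inv coxS)).
  exact: (implyP (forallP zI s)).
apply/forallP => s; apply/implyP => sI; have sS := fintype.subsetP IS s sI.
have /(length_ltP R coxS _ sS) := zI s sI.
by rewrite -{1}(invg_gen (cox_inv coxS) sS) -invMg !(cox_lengthV (cox_gen coxS) (cox_inv coxS)).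
Qed.

Lemma parabolic_projP I w : I \subset S ->
  parabolic_proj S I w \in <<I>>%g /\ forall s, s \in I ->
  nonneg (act ((parabolic_proj S I w)^-1 * w)^-1%g (alpha s)).
Proof.
move=> IS; rewrite /parabolic_proj; case: pickP => [x /andP[xI /(min_coset_repsP _ _ IS)[]]|no] //=.
(* The default [1] never occurs: an [x] in [<<I>>] that minimizes the length of [x^-1 * w] satisfies
   the condition of the pick. *)
case: (@arg_minnP _ 1%g (mem <<I>>%g) (fun x => cox_length S (x^-1 * w)%g) (group1 _)).
move=> x xI minx; have /negP[] := negbT (no x); apply/andP; split=> //.
rewrite finset.in_set (mem_genS (cox_gen coxS)); apply/forallP => s; apply/implyP => sI.
have sS := fintype.subsetP IS s sI.
have le : (cox_length S (x^-1 * w)%g <= cox_length S (s * (x^-1 * w))%g)%N.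
  have := minx (x * s)%g (groupM xI (mem_gen sI)).
  by rewrite /= invMg (invg_gen (cox_inv coxS) sS) -mulgA.
rewrite ltn_neqAle le andbT; have := cox_length_parity coxS (x^-1 * w)^-1%g sS.
rewrite -{1}(invg_gen (cox_inv coxS) sS) -invMg.
by rewrite !(cox_lengthV (cox_gen coxS) (cox_inv coxS)) eq_sym.
Qed.

Lemma inversions_supported I x b : I \subset S -> x \in <<I>>%g ->
  inversions S x b -> supported I b.
Proof.
move=> IS xI /(inversionsP coxS)[_ pb nb].
exact: (sign_change_supported coxS IS (groupVr xI) pb nb).
Qed.

(** In [w = x * y] with [x] the projection, [y^-1] keeps the simple roots of [I] positive. So it
    preserves the sign of [x^-1 b] whenever [b] is supported on [I]. *)
Lemma inversions_proj I w b : I \subset S ->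
  inversions S (parabolic_proj S I w) b <-> inversions S w b /\ supported I b.
Proof.
move=> IS; have [xI xw] := parabolic_projP w IS; set x := parabolic_proj S I w in xI xw *.
have wE c : act w^-1%g c = act (x^-1 * w)^-1%g (act x^-1%g c).
  by rewrite -geom_actM // -invMg mulKVg.
split=> [xb|[/(inversionsP coxS)[rb pb nb] sb]].
  have sb := inversions_supported IS xI xb; split=> //.
  move/(inversionsP coxS): xb => [rb pb nb]; apply/(inversionsP coxS); split=> //.
  rewrite wE -geom_actN //; apply: nonneg_act xw => //.
  by move=> r rI; rewrite ffunE (supported_act coxS IS (groupVr xI) sb) // oppr0.
apply/(inversionsP coxS); split=> //.
have rc := root_act coxS x^-1%g rb.
have [pc|//] := root_sign coxS rc.
have sc := supported_act coxS IS (groupVr xI) sb.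
have := nonneg_act sc pc xw; rewrite -wE => pd.
by case: (root_pos_neg coxS (root_act coxS _ rb) pd nb).
Qed.

Lemma parabolic_proj_le I x y : I \subset S -> wle x y ->
  wle (parabolic_proj S I x) (parabolic_proj S I y).
Proof.
by move=> IS xy b /(inversions_proj _ _ IS)[xb sb]; apply/inversions_proj => //; split=> //; apply: xy.
Qed.

Lemma parabolic_proj_proj I J w : I \subset J -> J \subset S ->
  parabolic_proj S I (parabolic_proj S J w) = parabolic_proj S I w.
Proof.
move=> IJ JS; have IS := fintype.subset_trans IJ JS.
apply: weak_le_anti => b /(inversions_proj _ _ IS)[wb sb]; apply/inversions_proj => //; split=> //.
  by case/(inversions_proj _ _ JS): wb.
apply/inversions_proj => //; split=> // r rJ; apply: sb.
by apply: contra rJ; apply: (fintype.subsetP IJ).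
Qed.

Lemma parabolic_proj_full w : parabolic_proj S S w = w.
Proof.
apply: weak_le_anti => b; first by case/inversions_proj.
move=> wb; apply/inversions_proj => //; split=> //.
by case/(inversionsP coxS): wb => rb _ _; apply: supported_root.
Qed.

Lemma parabolic_proj0 w : parabolic_proj S finset.set0 w = 1%g.
Proof.
by have [+ _] := parabolic_projP w (finset.sub0set S); rewrite gen0 => /set1gP.
Qed.

(* The bound is [x] followed by the longest element of [^I W]; its inversions
   are those of [x] together with all positive roots not supported on [I]. *)
Lemma parabolic_upper_bound I x : I \subset S -> x \in <<I>>%g ->
  exists y, forall b, inversions S y b <-> [/\ root b, nonneg b &
    supported I b -> nonneg (- act x^-1%g b)].
Proof.
move=> IS xI; have [m mI ml] := longest_elt R coxS IS.
have [M _ Ml] := longest_elt R coxS (subxx S).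
have Mneg c : root c -> nonneg c -> nonneg (- act M c).
  by move=> rc pc; apply: (nonpos_act (supported_root coxS rc)).
(* The inverse of the bound is [M * m * x^-1]. On roots supported on [I] the sign reversals by [M]
   and [m] cancel, leaving the sign of [x^-1 b]; a positive root not supported on [I] stays positive
   under [m * x^-1] and is made negative by [M]. *)
exists (M * m * x^-1)^-1%g => b; split=> [/(inversionsP coxS)[rb pb nb]|[rb pb sb]].
  split=> // sb; move: nb; rewrite invgK !geom_actM //.
  have rc := root_act coxS x^-1%g rb; have [pc|//] := root_sign coxS rc.
  have sc := supported_act coxS IS (groupVr xI) sb.
  have := Mneg _ (root_opp coxS (root_act coxS m rc)) (nonpos_act sc pc ml).
  rewrite geom_actN // opprK => pM.
  by move/(root_pos_neg coxS (root_act coxS M (root_act coxS m rc)) pM).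
apply/(inversionsP coxS); split=> //; rewrite invgK -mulgA geom_actM //.
have rd := root_act coxS (m * x^-1)%g rb.
have [pd|nd] := root_sign coxS rd; first exact: Mneg.
have sb' := sign_change_supported coxS IS (groupM mI (groupVr xI)) pb nd.
have sc := supported_act coxS IS (groupVr xI) sb'.
have rc := root_act coxS x^-1%g rb.
have nc := sb sb'; rewrite -geom_actN // in nc.
have sNc : supported I (act x^-1%g (- b)).
  by move=> r rI; rewrite geom_actN // ffunE sc // oppr0.
have := nonpos_act sNc nc ml.
rewrite -geom_actM // geom_actN // opprK => pd.
by case: (root_pos_neg coxS rd pd nd).
Qed.

(** The upper bound built from [x] lies above [u] and [w], hence above [v], and its inversions
    supported on [I] are inversions of [x]. *)
Lemma parabolic_proj_join I u w v x : I \subset S -> x \in <<I>>%g ->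
  is_weak_join R S u w v -> wle (parabolic_proj S I u) x ->
  wle (parabolic_proj S I w) x -> wle (parabolic_proj S I v) x.
Proof.
move=> IS xI [_ _ vmin] ux wx; have [y yP] := parabolic_upper_bound IS xI.
have bound z : wle (parabolic_proj S I z) x -> wle z y.
  move=> zx b zb; have /(inversionsP coxS)[rb pb _] := zb.
  apply/yP; split=> // sb.
  by have /(inversionsP coxS)[] : inversions S x b by apply/zx/inversions_proj.
move=> b /(inversions_proj _ _ IS)[/(vmin y (bound u ux) (bound w wx))/yP[rb pb sb] sb'].
by apply/(inversionsP coxS); split=> //; apply: sb.
Qed.

(** For an inversion [b] of [y] the root [x b] is positive: otherwise [b] would be supported on [I],
    where [y^-1] preserves positivity. So [x b] is an inversion of [x * y], hence of [x * z]. *)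
Lemma weak_le_cancel I J x y z : I \subset S -> x \in <<I>>%g ->
  y \in min_coset_reps S I J -> wle (x * y)%g (x * z)%g -> wle y z.
Proof.
move=> IS xI /(min_coset_repsP _ _ IS)[_ yI] /weak_leP yz.
apply/weak_leP => b rb pb nb; have := yz (act x b) (root_act coxS x rb).
rewrite !invMg !geom_actM // geom_actK //; apply=> //.
have [//|nxb] := root_sign coxS (root_act coxS x rb).
have sb := sign_change_supported coxS IS xI pb nxb.
have := nonneg_act sb pb yI => pyb.
by case: (root_pos_neg coxS (root_act coxS _ rb) pyb nb).
Qed.

End WeakOrder.

(** * The steps of the join recursion *)

Lemma initial_subset (gT : finGroupType) (s : seq gT) i j : (i <= j)%N ->
  initial s i \subset initial s j.
Proof.
move=> ij; apply/fintype.subsetP => x; rewrite !finset.in_set.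
by rewrite -(take_takel _ ij); apply: mem_take.
Qed.

Section JoinRecursion.
Variables (R : realType) (gT : finGroupType) (S : {set gT}).
Variables (s : seq gT) (u w v : gT).
Hypotheses (coxS : coxeter_system S) (sS : S = [set x in s]%SET).
Hypothesis joinv : is_weak_join R S u w v.
Local Notation I := (initial s).
Local Notation P k := (parabolic_proj S (I k) v).

Lemma initial_sub k : I k \subset S.
Proof.
by rewrite sS; apply/fintype.subsetP => x; rewrite !finset.in_set; apply: mem_take.
Qed.

Lemma join_step_candidate k :
  join_candidates R S s u w k (P k.-1) ((P k.-1)^-1 * P k)%g.
Proof.
have [uv wv _] := joinv.
have sub := initial_subset s (leq_pred k).
split; rewrite ?mulKVg; try exact: parabolic_proj_le (initial_sub k) _.
apply/(min_coset_repsP R coxS) => //; first exact: initial_sub.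
have [xI _] := parabolic_projP R coxS v (initial_sub k.-1).
have [yI _] := parabolic_projP R coxS v (initial_sub k).
split; first by rewrite groupM // groupV (fintype.subsetP (genS sub)).
(* [P k.-1] is also the projection of [P k], so the quotient is the coset factor of [P k]. *)
have [_] := parabolic_projP R coxS (P k) (initial_sub k.-1).
by rewrite (parabolic_proj_proj R coxS v sub (initial_sub k)).
Qed.

(** The product [P k.-1 * z] lies in the subgroup of [I k] above both projections, hence above
    [P k]; then [P k.-1] is cancelled. *)
Lemma join_step_min k z :
  join_candidates R S s u w k (P k.-1) z -> weak_le R S ((P k.-1)^-1 * P k)%g z.
Proof.
move=> [zI uz wz]; have [PI _ _] := join_step_candidate k.
have [xI _] := parabolic_projP R coxS v (initial_sub k.-1).
apply: (weak_le_cancel coxS (initial_sub k.-1) xI PI); rewrite mulKVg.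
apply: (parabolic_proj_join coxS (initial_sub k) _ joinv) => //.
have [zJ _] := elimT (min_coset_repsP R coxS _ _ (initial_sub k.-1)) zI.
by rewrite groupM // (fintype.subsetP (genS (initial_subset s (leq_pred k)))).
Qed.

Variable prec : nat -> rel gT.
Hypothesis precP : forall k, (0 < k <= size s)%N ->
  linear_extension R S (min_coset_reps S (I k.-1) (I k)) (prec k).

(** The candidate least in weak order precedes every other one in any linear extension, so it is the
    only minimal candidate. *)
Lemma join_step_minimal k z : (0 < k <= size s)%N ->
  is_minimal (prec k) (join_candidates R S s u w k (P k.-1)) z <->
  z = ((P k.-1)^-1 * P k)%g.
Proof.
move=> /precP[irr tr _ ext]; set z0 := (_ * _)%g.
have cz0 : join_candidates R S s u w k (P k.-1) z0 := join_step_candidate k.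
have [z0D _ _] := cz0.
have z0_prec z' : join_candidates R S s u w k (P k.-1) z' -> z0 != z' -> prec k z0 z'.
  by move=> cz'; apply: ext (join_step_min cz') => //; case: cz'.
split=> [[cz zmin]|->].
  by apply/eqP; apply: contraT => zN; have := zmin _ cz0; rewrite z0_prec // eq_sym.
split=> // z' cz'; have [z'D _ _] := cz'.
have [<-|/(z0_prec _ cz') z0z'] := eqVneq z0 z'; first by rewrite irr.
by apply/negP => z'z0; have := tr _ _ _ z'D z0D z0D z0z' z'z0; rewrite irr.
Qed.

End JoinRecursion.

Theorem mainTheorem5 (R : realType) (gT : finGroupType) (S : {set gT})
    (s : seq gT) (prec : nat -> rel gT) (u w : gT) :
  coxeter_system S ->
  uniq s -> S = [set x in s]%SET ->
  (forall k, (0 < k <= size s)%N ->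
     linear_extension R S
       (min_coset_reps S (initial s k.-1) (initial s k)) (prec k)) ->
  exists v : gT,
    [/\ is_weak_join R S u w v,
        exists j z : nat -> gT, join_recursion R S s prec u w j z
      & forall j z : nat -> gT, join_recursion R S s prec u w j z ->
          (forall k, (k <= size s)%N -> j k = parabolic_proj S (initial s k) v)
          /\ j (size s) = v].
Proof.
move=> coxS _ sS precP; have [v joinv] := weak_join_exists R coxS u w.
have P0 : parabolic_proj S (initial s 0) v = 1%g.
  suff -> : initial s 0 = finset.set0 by rewrite (parabolic_proj0 R coxS).
  by apply/finset.setP => x; rewrite !finset.in_set take0.
have minE := join_step_minimal coxS sS joinv precP.
exists v; split=> //.
  exists (fun k => parabolic_proj S (initial s k) v).
  exists (fun k => ((parabolic_proj S (initial s k.-1) v)^-1 *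
                    parabolic_proj S (initial s k) v)%g).
  by split=> // k /minE kP; rewrite mulKVg; split=> //; apply/kP.
move=> j z [j0 jS].
(* Once [j k] is the projection of [v], minimality determines the next [z], and the product
   telescopes to the next projection. *)
have jE k : (k <= size s)%N -> j k = parabolic_proj S (initial s k) v.
  elim: k => [|k IHk] ks; first by rewrite j0 P0.
  have [zk ->] := jS k.+1 ks; move: zk; rewrite /= IHk ?(ltnW ks) //.
  by move/(minE k.+1 _ ks) => ->; rewrite mulKVg.
split=> //; rewrite jE // /initial take_size -sS.
exact: (parabolic_proj_full R coxS).
Qed.
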